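(* Let $\epsilon\in(0,e^{-e^2})$. Suppose that $T_n$ is a uniform attachment tree with seed $S_\ell=P_\ell$ (a path on $\ell$ vertices), where $\ell\ge 1$ is an integer with $$\ell\le \frac{\log(1/\epsilon)}{\log\log(1/\epsilon)}.$$ Then, for all $n\ge 2\ell$, any seed-finding algorithm that outputs a vertex set $H_n$ of size $\ell$ satisfies $$\mathbb{P}\left\{ |H_n\cap P_\ell|\le \frac{\ell}{2}\right\}\ge \epsilon .$$
   Context: Uniform attachment tree with seed: let $\ell\ge 1$ and let $S_\ell$ be a tree on the vertex set $\{1,\ldots,\ell\}$. For $n>\ell$, a random tree $T_n$ on $\{1,\ldots,n\}$ is a uniform attachment tree with seed $S_\ell$ if it is generated as follows: $T_\ell=S_\ell$; and for $\ell<i\le n$, $T_i$ is obtained from $T_{i-1}$ by joining vertex $i$ by an edge to a vertex of $T_{i-1}$ chosen uniformly at random, independently of all previous choices. Path: $P_\ell$ is a tree on the vertex set $\{1,\ldots,\ell\}$ that has exactly two vertices of degree one and $\ell-2$ vertices of degree two (for $\ell=1$, a single vertex). The seed is identified with its vertex set, so $|H_n\cap P_\ell|=|H_n\cap\{1,\ldots,\ell\}|$. Seed-finding algorithm: it observes $T_n$ with the vertex labels hidden (it may depend on $n$, $\ell$, $\epsilon$ and on the knowledge that the seed is a path on $\ell$ vertices) and outputs a set $H_n$ of vertices of the observed tree. Formally: let $\sigma$ be a uniformly random permutation of $\{1,\ldots,n\}$ independent of $T_n$; the algorithm is a (possibly randomized, with independent randomness) map $A$ from trees on $\{1,\ldots,n\}$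 to subsets of $\{1,\ldots,n\}$, applied to the relabeled tree $\sigma(T_n)$, and $H_n=\sigma^{-1}(A(\sigma(T_n)))$. *)

(* Defs.v *)
From HB Require Import structures.
From mathcomp Require Import all_boot all_order all_algebra all_fingroup.
From mathcomp Require Import all_classical all_reals all_analysis.

Set Implicit Arguments.
Unset Strict Implicit.
Unset Printing Implicit Defensive.

Local Open Scope classical_set_scope.
Local Open Scope ring_scope.

(* The vertex set {1, ..., n} is 'I_n, the vertex v being the ordinal v - 1.
   A graph is its set of edges, an edge being a set of vertices; that edges
   have exactly two endpoints is part of is_tree. *)
Definition graph (n : nat) : Type := {set {set 'I_n}}.

Definition adj (n : nat) (E : graph n) : rel 'I_n :=
  fun x y => [set x; y]%SET \in E.

Definition degree (n : nat) (E : graph n) (v : 'I_n) : nat :=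
  #|[set e in E | v \in e]%SET|.

(* ucycle also accepts the degenerate closed walks of length 0 and 2 (an edge
   run back and forth), which are not cycles of the graph. *)
Definition is_tree (n : nat) (E : graph n) : Prop :=
  [/\ (0 < n)%N,
      forall e : {set 'I_n}, e \in E -> #|e| = 2%N,
      forall x y : 'I_n, connect (adj E) x y
    & forall c : seq 'I_n, ucycle (adj E) c -> (size c < 3)%N].

Definition is_path (l : nat) (E : graph l) : Prop :=
  is_tree E /\
  (l = 1%N \/
   #|[set v | degree E v == 1%N]%SET| = 2%N /\
   #|[set v | degree E v == 2%N]%SET| = (l - 2)%N).

Definition old (n : nat) : 'I_n -> 'I_n.+1 := widen_ord (leqnSn n).

Definition attach (n : nat) (E : graph n) (v : 'I_n) : graph n.+1 :=
  ([set ord_max; old v] |: [set (@old n @: e) | e : {set 'I_n} in E])%SET.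

(* The tree after m attachments: it has n = m + l vertices.  The vertex with
   value k + l is joined to c k, one of the k + l earlier ones. *)
Fixpoint ua_tree (l : nat) (S : graph l) (c : forall k : nat, 'I_(k + l))
    (m : nat) : graph (m + l) :=
  if m is m'.+1 then attach (ua_tree S c m') (c m') else S.

Definition seed_vertices (n l : nat) : {set 'I_n} :=
  [set v : 'I_n | (v < l)%N]%SET.

Definition relabel (n : nat) (s : {perm 'I_n}) (E : graph n) : graph n :=
  [set (s @: e) | e : {set 'I_n} in E]%SET.

(* A randomized seed-finding algorithm on n vertices: A w t is the output on
   the observed tree t when the internal randomness takes the value w.  Its
   values on graphs that are not trees are irrelevant. *)
Definition seed_finding_algorithm (dW : measure_display)
    (W : measurableType dW) (n l : nat)
    (A : W -> graph n -> {set 'I_n}) : Prop :=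
  forall t : graph n, is_tree t ->
    (forall H : {set 'I_n}, measurable [set w | A w t = H]) /\
    (forall w : W, #|A w t| = l).

(* The set H_n = s^-1 (A (s (T_n))), with w the randomness of A. *)
Definition found_set (W : Type) (n : nat) (A : W -> graph n -> {set 'I_n})
    (w : W) (s : {perm 'I_n}) (t : graph n) : {set 'I_n} :=
  (s @^-1: A w (relabel s t))%SET.

Definition uniform_on (d : measure_display) (O : measurableType d)
    (R : realType) (P : probability O R) (F : finType) (X : O -> F) : Prop :=
  (forall x : F, measurable (X @^-1` [set x])) /\
  (forall x : F, P (X @^-1` [set x]) = ((#|F|%:R)^-1 : R)%:E).

(* Mutual independence of the m attachment choices c 0, ..., c (m - 1), the
   hidden relabelling s and the randomness U of the algorithm.  Subfamilies are
   covered by taking some of the sets to be the full set. *)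
Definition independent_inputs (d dW : measure_display) (O : measurableType d)
    (W : measurableType dW) (R : realType) (P : probability O R) (l m : nat)
    (c : forall k : nat, O -> 'I_(k + l)) (s : O -> {perm 'I_(m + l)})
    (U : O -> W) : Prop :=
  forall (B : forall k : nat, set 'I_(k + l)) (C : set {perm 'I_(m + l)})
         (V : set W), measurable V ->
  P ((\bigcap_(k in [set k | (k < m)%N]) (c k @^-1` B k)) `&`
     (s @^-1` C) `&` (U @^-1` V)) =
  ((\prod_(k < m) P (c k @^-1` B k)) * P (s @^-1` C) * P (U @^-1` V))%E.

(* Main.v *)
(* With probability \prod_(k < l) 1 / (k + l), the vertices of value l, ..., 2l - 1
   successively prolong the seed path from one fixed endpoint into a path on 2l
   vertices.  Reversing this path (and fixing all other vertices) maps such a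
   history of attachments to an equally likely one; composing the hidden
   relabelling with the reversal leaves the observed tree, hence the output,
   unchanged, while exchanging the two halves of the path.  As an output of size l
   cannot contain more than l / 2 vertices of each half, the algorithm fails on
   one of the two histories, so its failure probability is at least half of the
   product above, hence at least (2l)^(-l), which is at least eps. *)
Require Import Defs.
From HB Require Import structures.
From mathcomp Require Import all_boot all_order all_algebra all_fingroup.
From mathcomp Require Import all_classical all_reals all_analysis.
From mathcomp Require Import zify lra ring.

Set Implicit Arguments.
Unset Strict Implicit.
Unset Printing Implicit Defensive.
Import Order.TTheory GRing.Theory Num.Theory.

Local Open Scope classical_set_scope.
Local Open Scope ring_scope.

(** * The numerical bound on [eps] *)

(** The factor for k = 0 is l, and the extra 2 turns it into 2l; each of the other l - 1 factors is
    below 2l. *)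
Lemma double_prod_leq (l : nat) :
  (0 < l)%N -> (2 * \prod_(k < l) (k + l) <= (2 * l) ^ l)%N.
Proof.
case: l => // l _; rewrite big_ord_recl add0n mulnA expnS leq_mul2l /=.
rewrite -[X in (_ ^ X)%N]card_ord -prod_nat_const leq_prod// => i _.
by have := ltn_ord i; rewrite /bump /=; lia.
Qed.

(** For L = ln (1/eps) the hypothesis reads l ln L <= L, so L^l = exp (l ln L) <= 1/eps. The bound
    eps < exp (- exp 2) gives ln L > 2, whence 2l <= l ln L <= L and (2l)^l <= L^l. *)
Lemma eps_le_inv_prod (R : realType) (eps : R) (l : nat) :
  0 < eps -> eps < expR (- expR 2) -> (0 < l)%N ->
  l%:R <= ln (1 / eps) / ln (ln (1 / eps)) ->
  eps <= (2 * \prod_(k < l) (k + l))%N%:R^-1.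
Proof.
move=> eps0 epslt l0; rewrite div1r => hl.
set L := ln eps^-1 in hl.
have Lgt : expR 2 < L.
  rewrite /L lnV ?posrE// ltrNr -ltr_expR lnK ?posrE//.
have L0 : 0 < L by apply: lt_trans Lgt; exact: expR_gt0.
have lnL : 2 < ln L by rewrite -ltr_expR lnK ?posrE.
have lnL0 : 0 < ln L by apply: lt_trans lnL.
have hl' : l%:R * ln L <= L by rewrite -ler_pdivlMr.
have l0R : 0 < l%:R :> R by rewrite ltr0n.
have l2L : (2 * l)%N%:R <= L.
  apply: le_trans hl'; rewrite natrM mulrC ler_pM2l//; exact: ltW.
rewrite -[leLHS]invrK lef_pV2 ?posrE ?invr_gt0//; last first.
  by rewrite ltr0n muln_gt0 /= prodn_gt0// => i; lia.
have -> : eps^-1 = expR L by rewrite lnK// posrE invr_gt0.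
apply: le_trans (_ : (2 * l)%N%:R ^+ l <= _).
  by rewrite -natrX ler_nat double_prod_leq.
have : (2 * l)%N%:R ^+ l <= L ^+ l by rewrite lerXn2r// nnegrE// ltW.
move=> /le_trans; apply.
by rewrite -[X in X ^+ l](lnK (x := L)) ?posrE// -expRM_natl ler_expR.
Qed.

(** * Attachment and relabelling preserve trees *)

Lemma adj_sym (n : nat) (E : graph n) : symmetric (adj E).
Proof. by move=> x y; rewrite /adj finset.setUC. Qed.

Lemma adj_neq (n : nat) (E : graph n) (x y : 'I_n) :
  is_tree E -> adj E x y -> x != y.
Proof.
move=> [_ hE _ _] /hE; rewrite cards2.
by case: eqVneq.
Qed.

Lemma old_inj (n : nat) : injective (@old n).
Proof. by move=> x y /(congr1 val) /= /val_inj. Qed.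

Lemma old_neq_max (n : nat) (x : 'I_n) : old x != ord_max.
Proof. by rewrite -val_eqE /= ltn_eqF// ltn_ord. Qed.

Lemma imset_set2 (aT rT : finType) (f : aT -> rT) (x y : aT) :
  (f @: [set x; y])%SET = [set f x; f y]%SET.
Proof. by rewrite imsetU1 imset_set1. Qed.

Lemma ord_max_notin_old (n : nat) (e : {set 'I_n}) :
  ord_max \notin (@old n @: e)%SET.
Proof. by apply/imsetP => -[x _] /esym/eqP; rewrite (negPf (old_neq_max x)). Qed.

Lemma adj_attach_old (n : nat) (E : graph n) (v x y : 'I_n) :
  adj (attach E v) (old x) (old y) = adj E x y.
Proof.
rewrite /adj /attach in_setU1 -imset_set2 (mem_imset _ _ (imset_inj (@old_inj n))).
case: eqVneq => //= h; have := ord_max_notin_old [set x; y]%SET.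
by rewrite h !inE eqxx.
Qed.

Lemma adj_attach_max (n : nat) (E : graph n) (v : 'I_n) (y : 'I_n.+1) :
  adj (attach E v) ord_max y -> y = ord_max \/ y = old v.
Proof.
rewrite /adj /attach in_setU1 => /orP[/eqP h|/imsetP[e _ h]].
  have : y \in [set ord_max; old v]%SET by rewrite -h !inE eqxx orbT.
  by rewrite !inE => /orP[]/eqP; [left|right].
by have := ord_max_notin_old e; rewrite -h !inE eqxx.
Qed.

Lemma unlift_old (n : nat) (x : 'I_n.+1) :
  x != ord_max -> exists y : 'I_n, x = old y.
Proof.
move=> hx; have xn : (x < n)%N.
  by rewrite ltn_neqAle -ltnS ltn_ord andbT; move: hx; rewrite -val_eqE.
by exists (Ordinal xn); apply: val_inj.
Qed.

Lemma attach_tree (n : nat) (E : graph n) (v : 'I_n) :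
  is_tree E -> is_tree (attach E v).
Proof.
move=> tE; have [n0 hE cE cycE] := tE; split => //.
- move=> e /setU1P[->|/imsetP[f fE ->]].
    by rewrite cards2 eq_sym old_neq_max.
  by rewrite card_imset ?hE//; exact: old_inj.
- have old_conn x y : connect (adj (attach E v)) (old x) (old y).
    have /connectP[p pp ->] := cE x y.
    elim: p x pp => [x _|z p IH x /= /andP[xz /IH]]; first exact: connect0.
    by apply: connect_trans; apply: connect1; rewrite adj_attach_old.
  have max_conn : connect (adj (attach E v)) ord_max (old v).
    by apply: connect1; rewrite /adj /attach setU11.
  have s_conn := sym_connect_sym (@adj_sym _ (attach E v)).
  suff h x : connect (adj (attach E v)) x (old v).
    by move=> x y; apply: connect_trans (h x) _; rewrite s_conn.
  case: (eqVneq x ord_max) => [->//|/unlift_old[z ->]]; exact: old_conn.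
- move=> s /andP[sC sU]; rewrite ltnNge; apply/negP => s3.
  (* A cycle through the new vertex would give it two distinct neighbours, but it is a leaf; a cycle
     avoiding it comes from a cycle of [E]. *)
  case: (boolP (ord_max \in s)) => hs.
    have [k s' es] := rot_to hs.
    have sC' : path.cycle (adj (attach E v)) (ord_max :: s') by rewrite -es rot_cycle.
    have sU' : uniq (ord_max :: s') by rewrite -es rot_uniq.
    have s3' : (3 <= size (ord_max :: s'))%N by rewrite -es size_rot.
    case: s' {es s3 hs} sC' sU' s3' => [//|a]; case/lastP => [//|s' b].
    rewrite /= rcons_path last_rcons mem_rcons !inE => /andP[ha].
    move=> /andP[_ hb] /and3P[hm hab _] _.
    move: hm hab; rewrite mem_rcons in_cons; case/norP => am /norP[bm _] /norP[ab _].
    move: ha => /adj_attach_max [e|ea]; first by rewrite e eqxx in am.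
    move: hb; rewrite adj_sym => /adj_attach_max [e|eb].
      by rewrite e eqxx in bm.
    by rewrite ea eb eqxx in ab.
  have [s' es] : exists s' : seq 'I_n, s = map (@old n) s'.
    elim: s hs {s3 sC sU} => [|a s IH]; first by exists [::].
    rewrite in_cons => /norP[am /IH[s' ->]].
    by have [|b ->] := @unlift_old _ a; [rewrite eq_sym|exists (b :: s')].
  have /cycE : ucycle (adj E) s'.
    rewrite /ucycle; move: sC sU; rewrite es (map_inj_uniq (@old_inj n)) => sC ->.
    by move: sC; rewrite cycle_map (eq_cycle (e' := adj E)) ?andbT// => x y; exact: adj_attach_old.
  by move: s3; rewrite es size_map leqNgt => /negP.
Qed.

Lemma adj_relabel (n : nat) (s : {perm 'I_n}) (E : graph n) (x y : 'I_n) :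
  adj (relabel s E) (s x) (s y) = adj E x y.
Proof.
by rewrite /adj /relabel -imset_set2 (mem_imset _ _ (imset_inj (@perm_inj _ s))).
Qed.

Lemma relabel_tree (n : nat) (s : {perm 'I_n}) (E : graph n) :
  is_tree E -> is_tree (relabel s E).
Proof.
move=> [n0 hE cE cycE]; split => //.
- by move=> _ /imsetP[f fE ->]; rewrite card_imset ?hE//; exact: perm_inj.
- move=> x y; rewrite -[x](permKV s) -[y](permKV s).
  have /connectP[p pp ->] := cE ((s^-1)%g x) ((s^-1)%g y).
  elim: p ((s^-1)%g x) pp => [z _|z p IH z' /= /andP[xz /IH]]; first exact: connect0.
  by apply: connect_trans; apply: connect1; rewrite adj_relabel.
- move=> t tC; rewrite -(size_map (s^-1)%g); apply: cycE.
  move: tC; rewrite /ucycle (map_inj_uniq perm_inj) => /andP[tC ->].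
  rewrite andbT cycle_map (eq_cycle (e' := adj (relabel s E)))// => x y /=.
  by rewrite -(adj_relabel s) !permKV.
Qed.

Lemma ua_tree_tree (l : nat) (S : graph l) (c : forall k : nat, 'I_(k + l))
    (m : nat) : is_tree S -> is_tree (ua_tree S c m).
Proof. by move=> tS; elim: m => //= m; exact: attach_tree. Qed.

(** * Listing the seed path from end to end *)

Lemma set2_injr (T : finType) (u : T) : injective (fun a => [set u; a]%SET).
Proof.
move=> a b h.
have := set22 u a; rewrite h !inE => /orP[/eqP au|/eqP//].
by have := set22 u b; rewrite -h !inE au orbb => /eqP.
Qed.

Lemma degree_ge3 (n : nat) (E : graph n) (u a b c : 'I_n) :
  uniq [:: a; b; c] -> adj E u a -> adj E u b -> adj E u c ->
  (3 <= degree E u)%N.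
Proof.
move=> abc ua ub uc.
have := map_inj_uniq (@set2_injr _ u) [:: a; b; c]; rewrite abc => /card_uniqP /= <-.
apply/subset_leq_card/fintype.subsetP => e; rewrite !inE.
by move=> /or3P[] /eqP ->; rewrite ?set21 andbT.
Qed.

(** The classes of degree 1 and degree 2 are disjoint and their sizes add up to l, so they exhaust
    the vertices. For l = 1 there is no edge. *)
Lemma degree_leq2 (l : nat) (S : graph l) (v : 'I_l) :
  is_path S -> (degree S v <= 2)%N.
Proof.
move=> [[l0 hE _ _] [l1|[h1 h2]]].
  apply: (@leq_trans 0%N) => //; rewrite leqn0 cards_eq0.
  apply/eqP/setP => e; rewrite !inE; apply/negP => /andP[/hE he _].
  by have := max_card (mem e); rewrite he card_ord l1.
have := cardsUI [set v | degree S v == 1%N]%SET [set v | degree S v == 2%N]%SET.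
rewrite h1 h2 => h.
have dis : ([set v | degree S v == 1%N] :&: [set v | degree S v == 2%N])%SET = finset.set0.
  by apply/setP => x; rewrite !inE; case: eqP => // ->.
(* Needed because [l - 2] is truncated: only now is 2 + (l - 2) equal to l. *)
have l2 : (2 <= l)%N by rewrite -h1 -[X in (_ <= X)%N]card_ord max_card.
rewrite dis cards0 in h.
have /eqP/setP/(_ v) : ([set v | degree S v == 1%N] :|:
    [set v | degree S v == 2%N])%SET == [set: 'I_l]%SET.
  by rewrite eqEcard finset.subsetT cardsT card_ord; lia.
by rewrite !inE => /orP[]/eqP->.
Qed.

Lemma connect_exit (T : finType) (e : rel T) (A : {pred T}) (x y : T) :
  connect e x y -> x \in A -> y \notin A ->
  exists u v, [/\ u \in A, v \notin A & e u v].
Proof.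
move=> /connectP[p pp ->]; elim: p x pp => [x _ /= -> //|z p IH x /=].
move=> /andP[xz /IH{}IH] xA yA; case: (boolP (z \in A)) => zA; first exact: IH.
by exists x, z.
Qed.

(* A longest simple path is Hamiltonian: otherwise an edge leaves it, from an
   endpoint (the path extends) or an inner vertex (which then has degree 3). *)
Lemma hamiltonian_path (l : nat) (S : graph l) :
  is_path S -> exists q : seq 'I_l, [/\ uniq q, sorted (adj S) q & q =i predT].
Proof.
move=> pS; have [[l0 _ cS _] _] := pS.
pose Q n := [exists t : n.-tuple 'I_l, uniq t && sorted (adj S) t].
have exQ : exists n, Q n by exists 0%N; apply/existsP; exists [tuple].
have ubQ n : Q n -> (n <= l)%N.
  move=> /existsP[t /andP[/card_uniqP ut _]].
  by rewrite -(size_tuple t) -ut -[leqRHS]card_ord max_card.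
have [N /existsP[[t /eqP tN] /= /andP[ut st]] maxN] := ex_maxnP exQ ubQ.
have maxt (t' : seq 'I_l) : uniq t' -> sorted (adj S) t' -> (size t' <= size t)%N.
  rewrite tN => ut' st'; apply: maxN; apply/existsP.
  by exists (in_tuple t'); rewrite ut'.
exists t; split=> // x; rewrite [RHS]inE; apply/negPn/negP => xt.
have [t0|[h ht]] : t = [::] \/ exists h, h \in t.
  by case: (t) => [|h ?]; [left|right; exists h; rewrite mem_head].
  by have := maxt [:: x] isT isT; rewrite t0.
have [u [v [hu hv uv]]] := connect_exit (cS h x) ht xt.
have [s1 [s2 e]] : exists s1 s2, t = s1 ++ u :: s2.
  by case/splitPr: hu => s1 s2; exists s1, s2.
have uvt : uniq (v :: t) by rewrite /= hv.
case/lastP: s1 e => [|s1 a] e.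
  have /maxt : uniq (v :: t) by [].
  rewrite /= ltnn => H; apply: notF; apply: H.
  by rewrite e /= adj_sym uv; rewrite e in st.
case: s2 e => [|b s2] e.
  have /maxt : uniq (rcons t v) by rewrite rcons_uniq hv.
  rewrite size_rcons ltnn => H; apply: notF; apply: H.
  rewrite e cats1 -(cats1 _ v) -cats1 -catA /= sorted_cat_cons; move: st.
  by rewrite e sorted_cat_cons => /andP[-> _] /=; rewrite uv.
have : (3 <= degree S u)%N.
  move: st; rewrite e cat_rcons sorted_cat_cons /= => /and3P[_ au /andP[ub _]].
  apply: (@degree_ge3 _ _ u a b v) => //; last by rewrite adj_sym.
  move: hv; rewrite e cat_rcons mem_cat !inE !negb_or => /andP[_ /and4P[av _ bv _]].
  move: ut; rewrite e cat_rcons cat_uniq => /and3P[_ _] /= /andP[].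
  rewrite !inE !negb_or => /and3P[_ ab _] _.
  by rewrite ab eq_sym av eq_sym bv.
by rewrite ltnNge degree_leq2.
Qed.

(** The edge closes the segment from position i to position j into a closed walk on j - i + 1
    distinct vertices, which a tree allows only when that number is at most 2. *)
Lemma tree_chord_free (n : nat) (E : graph n) (q : seq 'I_n) (x0 : 'I_n)
    (i j : nat) : is_tree E -> uniq q -> sorted (adj E) q ->
  (i < j < size q)%N -> adj E (nth x0 q i) (nth x0 q j) -> j = i.+1.
Proof.
move=> [_ _ _ cycE] uq sq /andP[ij jq] eij; apply/eqP; rewrite eqn_leq ij andbT.
pose c := drop i (take j.+1 q).
have szc : size c = (j.+1 - i)%N by rewrite size_drop size_take_min; lia.
have ucyc : ucycle (adj E) c.
  rewrite /ucycle drop_uniq ?take_uniq// andbT.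
  have : sorted (adj E) c by apply/drop_sorted/take_sorted.
  have c0 : nth x0 c 0 = nth x0 q i by rewrite nth_drop addn0 nth_take//; lia.
  have c1 : nth x0 c (size c).-1 = nth x0 q j.
    by rewrite szc nth_drop nth_take; [congr nth; lia|lia].
  case: c szc c0 c1 => [|x p]; first by move=> /= ?; lia.
  by rewrite nth_last /= rcons_path => _ -> -> ->; rewrite adj_sym.
have := cycE _ ucyc; rewrite szc; lia.
Qed.

Definition consecutive_edges (l : nat) (S : graph l) (q : seq 'I_l) : Prop :=
  forall (x0 : 'I_l) (e : {set 'I_l}), e \in S <->
    exists i, (i.+1 < l)%N /\ e = [set nth x0 q i; nth x0 q i.+1]%SET.

(** A Hamiltonian path of a tree carries all its edges, any further one being a chord. *)
Lemma path_seed_edges (l : nat) (S : graph l) :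
  is_path S -> exists q : seq 'I_l, [/\ uniq q, size q = l & consecutive_edges S q].
Proof.
move=> pS; have [tS _] := pS; have [q [uq sq qT]] := hamiltonian_path pS.
have szq : size q = l.
  by rewrite -(card_uniqP uq) -[RHS]card_ord; apply: eq_card.
exists q; split=> // x0 e; split; last first.
  move=> [i [il ->]]; rewrite -/(adj S _ _).
  by apply: (sortedP x0 sq); rewrite szq.
move=> eS; have [_ hE _ _] := tS.
have /eqP/cards2P[x [y [xy exy]]] := hE e eS.
wlog xyq : x y xy exy / (index x q < index y q)%N.
  move=> h; have : index x q != index y q.
    apply: contraNneq xy => /(congr1 (nth x0 q)).
    by rewrite !nth_index ?qT// => ->.
  rewrite neq_ltn => /orP[]; first exact: h.
  by apply: (h y x); rewrite // 1?eq_sym// finset.setUC.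
have yq : (index y q < size q)%N by rewrite index_mem qT.
have := @tree_chord_free _ S q x0 (index x q) (index y q) tS uq sq.
rewrite xyq yq !nth_index ?qT// /adj -exy => /(_ isT eS) h.
by exists (index x q); rewrite -h !nth_index ?qT //; rewrite szq in yq.
Qed.

(** * Edges of the attachment tree in terms of vertex values *)

Lemma set2_eqP (T : finType) (x y a b : T) :
  [set x; y]%SET = [set a; b]%SET -> x = a /\ y = b \/ x = b /\ y = a.
Proof.
move=> h; have := set21 x y; rewrite h !inE => /orP[]/eqP xa.
  by left; split=> //; move: h; rewrite xa => /set2_injr.
by right; split=> //; move: h; rewrite xa [RHS]finset.setUC => /set2_injr.
Qed.

Lemma tree_eq (n : nat) (E F : graph n) :
  is_tree E -> is_tree F -> adj E =2 adj F -> E = F.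
Proof.
move=> [_ hE _ _] [_ hF _ _] EF; apply/setP => e.
apply/idP/idP => he; first have /eqP := hE _ he; last have /eqP := hF _ he.
  by move=> /cards2P[x [y [_ ee]]]; move: he; rewrite ee -/(adj E x y) EF.
by move=> /cards2P[x [y [_ ee]]]; move: he; rewrite ee -/(adj F x y) -EF.
Qed.

(** Stated on natural numbers, so that vertices of ['I_l], ['I_(k + l)] and ['I_(m + l)] are
    compared without widening maps. *)
Definition ua_edge (l : nat) (S : graph l) (c : forall k : nat, 'I_(k + l))
    (m a b : nat) : Prop :=
  (exists x y : 'I_l, [/\ adj S x y, a = x & b = y]) \/
  (exists k, (k < m)%N /\
    (a = (k + l)%N /\ b = c k \/ b = (k + l)%N /\ a = c k)).

Lemma ua_edge_sym (l : nat) (S : graph l) (c : forall k : nat, 'I_(k + l))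
    (m a b : nat) : ua_edge S c m a b -> ua_edge S c m b a.
Proof.
move=> [[x [y [xy -> ->]]]|[k [km h]]].
  by left; exists y, x; rewrite adj_sym.
by right; exists k; split=> //; case: h; [right|left].
Qed.

Lemma adj_ua_tree (l : nat) (S : graph l) (c : forall k : nat, 'I_(k + l))
    (m : nat) (x y : 'I_(m + l)) : is_tree S ->
  adj (ua_tree S c m) x y <-> ua_edge S c m x y.
Proof.
move=> tS; elim: m x y => [|m IH] x y.
  split=> [xy|[[x' [y' [xy /val_inj -> /val_inj ->]]]|[k []]]]//.
  by left; exists x, y.
have max_case z : adj (ua_tree S c m.+1) ord_max z <-> ua_edge S c m.+1 (m + l)%N z.
  split=> [h|].
    have := adj_neq (ua_tree_tree c m.+1 tS) h; move: h => /=.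
    move=> /adj_attach_max[->|-> _]; first by rewrite eqxx.
    by right; exists m; split=> //; left.
  move=> [[a [b [_ e _]]]|[k [km [[e1 e2]|[_ e2]]]]].
  - by have := ltn_ord a; rewrite -e ltnNge leq_addl.
  - have ek : m = k by lia.
    subst k; have -> : z = old (c m) by exact: val_inj.
    by rewrite /adj /= /attach setU11.
  - by have := ltn_ord (c k); rewrite -e2; lia.
case: (eqVneq x (@ord_max (m + l))) => [->|/(@unlift_old (m + l))[x' ->]].
  exact: max_case.
case: (eqVneq y (@ord_max (m + l))) => [->|/(@unlift_old (m + l))[y' ->]].
  by rewrite adj_sym; split=> [/max_case/ua_edge_sym|/ua_edge_sym/max_case].
rewrite [adj _ _ _]adj_attach_old; split=> [/IH|h]; last apply/IH.
  move=> [|[k [km h]]]; first by left.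
  by right; exists k; split=> //; exact: ltnW.
case: h => [|[k [km h]]]; first by left.
have hx := ltn_ord x'; have hy := ltn_ord y'.
(* For k = m one endpoint would be the newest vertex, of value m + l, but both endpoints are old. *)
have hk : (k < m)%N.
  case: h => -[e _].
    by have : (x' = k + l :> nat)%N := e; lia.
  by have : (y' = k + l :> nat)%N := e; lia.
by right; exists k.
Qed.

Lemma eq_ua_tree (l : nat) (S : graph l) (c c' : forall k : nat, 'I_(k + l))
    (m : nat) : (forall k, (k < m)%N -> c k = c' k) ->
  ua_tree S c m = ua_tree S c' m.
Proof.
elim: m => //= m IH h; rewrite IH ?h// => k km; apply: h; exact: ltnW.
Qed.

(** * Reversal of the path on 2l vertices *)

(* If q lists the seed path and each vertex of value k + l, k < l, was joined to
   the vertex [node q (k + l).-1], then node q 0, ..., node q (2l - 1) lists a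
   path whose first half is the seed: for i >= l the default value of nth makes
   node q i = i. *)
Definition node (l : nat) (q : seq 'I_l) (i : nat) : nat := nth i (map val q) i.

(* Reverses that path on 2l vertices and fixes all later vertices. *)
Definition flip (l : nat) (q : seq 'I_l) (a : nat) : nat :=
  if (a < 2 * l)%N then
    node q ((2 * l).-1 - (if (a < l)%N then index a (map val q) else a))
  else a.

Section Flip.
Variables (l : nat) (q : seq 'I_l).
Hypotheses (uq : uniq q) (szq : size q = l).

Lemma node_lt (i : nat) : (i < l)%N -> (node q i < l)%N.
Proof.
move=> il; rewrite /node.
have /mapP[x _ ->] : nth i (map val q) i \in map val q.
  by rewrite mem_nth// size_map szq.
exact: ltn_ord.
Qed.

Lemma node_ge (i : nat) : (l <= i)%N -> node q i = i.
Proof. by move=> il; rewrite /node nth_default// size_map szq. Qed.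

Lemma nodeE (x0 : 'I_l) (i : nat) : (i < l)%N -> node q i = nth x0 q i.
Proof. by move=> il; rewrite /node (nth_map x0) ?szq. Qed.

Lemma node_surj (a : nat) :
  (a < 2 * l)%N -> exists2 i, (i < 2 * l)%N & a = node q i.
Proof.
move=> a2; case: (ltnP a l) => al; last by exists a; rewrite ?node_ge.
have aq : a \in map val q.
  have <- : val (Ordinal al) = a by [].
  apply: map_f; have /(@uniq_min_size _ q (enum 'I_l)) : uniq q by [].
  by case=> [? _||_ ->]; rewrite ?mem_enum// szq size_enum_ord.
exists (index a (map val q)); last by rewrite /node nth_index.
by move: aq; rewrite -index_mem size_map szq; lia.
Qed.

(** In terms of positions, the reversal is i -> 2l - 1 - i: [index] recovers the position of a seed
    vertex, while a vertex of value at least l is its own position. *)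
Lemma flip_node (i : nat) :
  (i < 2 * l)%N -> flip q (node q i) = node q ((2 * l).-1 - i).
Proof.
move=> i2; rewrite /flip; case: (ltnP i l) => il; last first.
  by rewrite node_ge// i2 ltnNge il.
have := node_lt il => nl; rewrite nl ifT; last by lia.
rewrite /node index_uniq// ?size_map ?szq// map_inj_uniq//; exact: val_inj.
Qed.

Lemma flip_id (a : nat) : (2 * l <= a)%N -> flip q a = a.
Proof. by rewrite leqNgt /flip => /negPf->. Qed.

Lemma flipK : involutive (flip q).
Proof.
move=> a; case: (ltnP a (2 * l)) => [/node_surj[i il ->]|al].
  by rewrite !flip_node; [congr node|..]; lia.
by rewrite !flip_id.
Qed.

Lemma flip_seed (a : nat) : (a < l)%N -> (l <= flip q a)%N.
Proof.
move=> al; have /node_surj[i il e] : (a < 2 * l)%N by lia.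
have il' : (i < l)%N by rewrite ltnNge; apply/negP => li; have := node_ge li; lia.
by rewrite e flip_node// node_ge; lia.
Qed.

Lemma flip_lt (n a : nat) : (2 * l <= n)%N -> (a < n)%N -> (flip q a < n)%N.
Proof.
move=> ln an; case: (ltnP a (2 * l)) => [/node_surj[i il ->]|al].
  rewrite flip_node//; case: (ltnP ((2 * l).-1 - i) l) => h.
    by have := node_lt h; lia.
  by rewrite node_ge//; lia.
by rewrite flip_id.
Qed.

(** By [flip_lt], the fallback value of [insubd] is never taken once 2l <= n. *)
Definition flip_ord (n : nat) (a : 'I_n) : 'I_n := insubd a (flip q a).

Lemma val_flip_ord (n : nat) (a : 'I_n) :
  (2 * l <= n)%N -> flip_ord a = flip q a :> nat.
Proof. by move=> ln; rewrite /flip_ord val_insubd flip_lt. Qed.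

Lemma flip_ordK (n : nat) : (2 * l <= n)%N -> involutive (@flip_ord n).
Proof. by move=> ln a; apply: val_inj; rewrite /= !val_flip_ord ?flipK. Qed.

End Flip.

(** * The reversal acting on trees and on outputs *)

(** Edges of the long path go to edges of the same path. Any other edge joins a vertex k + l >= 2l,
    which is fixed, to its parent, and [c'] is chosen to reverse that parent. *)
Lemma ua_edge_flip (l m : nat) (S : graph l) (q : seq 'I_l)
    (c c' : forall k : nat, 'I_(k + l)) (a b : nat) :
  (0 < l)%N -> (l <= m)%N -> uniq q -> size q = l ->
  consecutive_edges S q ->
  (forall k, (k < l)%N -> c k = node q (k + l).-1 :> nat) ->
  (forall k, (k < l)%N -> c' k = node q (k + l).-1 :> nat) ->
  (forall k, (l <= k < m)%N -> c' k = flip q (c k) :> nat) ->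
  ua_edge S c m a b -> ua_edge S c' m (flip q a) (flip q b).
Proof.
move=> l0 lm uq szq qS hc hc' hcc.
have sedge i : (i.+1 < l)%N -> ua_edge S c' m (node q i) (node q i.+1).
  move=> il; pose x0 := Ordinal l0; left; exists (nth x0 q i), (nth x0 q i.+1).
  split; [|by rewrite (nodeE szq x0)//; lia..].
  by apply/(qS x0); exists i.
have pedge i : (i.+1 < 2 * l)%N -> ua_edge S c' m (node q i) (node q i.+1).
  move=> il; case: (ltnP i.+1 l) => [/sedge//|li].
  right; exists (i.+1 - l)%N; split; first by lia.
  by right; split; [rewrite node_ge//; lia|rewrite hc'; [congr node; lia|lia]].
have fedge i : (i.+1 < 2 * l)%N ->
    ua_edge S c' m (flip q (node q i)) (flip q (node q i.+1)).
  move=> il; rewrite !flip_node//; try lia.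
  have -> : ((2 * l).-1 - i = ((2 * l).-1 - i.+1).+1)%N by lia.
  by apply/ua_edge_sym/pedge; lia.
move=> [[x [y [xy -> ->]]]|[k [km h]]].
  have /(qS x)[i [il /set2_eqP h]] : [set x; y]%SET \in S by [].
  have il2 : (i.+1 < 2 * l)%N by lia.
  have := fedge i il2; rewrite !(nodeE szq x)//; last exact: ltnW.
  by case: h => -[<- <-]// /ua_edge_sym.
have hk : ua_edge S c' m (flip q (k + l)) (flip q (c k)).
  (* For k < l this attachment is the path edge between positions k + l - 1 and k + l. *)
  case: (ltnP k l) => kl.
    have k2 : ((k + l).-1.+1 < 2 * l)%N by lia.
    have := fedge _ k2; rewrite -hc// prednK; last by lia.
    by move=> /ua_edge_sym; rewrite node_ge//; lia.
  right; exists k; split=> //; left; rewrite hcc ?kl//; split=> //.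
  by rewrite flip_id//; lia.
by case: h => -[-> ->] //; exact: ua_edge_sym.
Qed.

Lemma relabel_ua_tree_flip (l m : nat) (S : graph l) (q : seq 'I_l)
    (c c' : forall k : nat, 'I_(k + l)) (s : {perm 'I_(m + l)}) :
  is_tree S -> (l <= m)%N -> uniq q -> size q = l ->
  consecutive_edges S q ->
  (forall k, (k < l)%N -> c k = node q (k + l).-1 :> nat) ->
  (forall k, (k < l)%N -> c' k = node q (k + l).-1 :> nat) ->
  (forall k, (l <= k < m)%N -> c' k = flip q (c k) :> nat) ->
  (forall x, s x = flip q x :> nat) ->
  ua_tree S c' m = relabel s (ua_tree S c m).
Proof.
move=> tS lm uq szq qS hc hc' hcc hs; have [l0 _ _ _] := tS.
apply: tree_eq => [||x y]; [exact: ua_tree_tree|exact/relabel_tree/ua_tree_tree|].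
rewrite -[x](permKV s) -[y](permKV s) adj_relabel.
move: ((s^-1)%g x) ((s^-1)%g y) => {}x {}y; apply/idP/idP.
  (* As [flip] is an involution, [c] and [c'] play symmetric roles, which gives the converse
     inclusion. *)
  move=> /(adj_ua_tree _ _ _ tS)/(@ua_edge_flip l m S q c' c).
  rewrite !hs !flipK// => h; apply/(adj_ua_tree _ _ _ tS)/h => // k km.
  by rewrite hcc// flipK.
move=> /(adj_ua_tree _ _ _ tS)/(@ua_edge_flip l m S q c c').
by rewrite -!hs => h; apply/(adj_ua_tree _ _ _ tS)/h.
Qed.

(** The seed part of [H] and the [s]-image of the seed part of its preimage both lie in [H]; they
    are disjoint since [s] moves every seed vertex out of the seed. Their sizes thus add up to at
    most l. *)
Lemma flip_half (l n : nat) (q : seq 'I_l) (H : {set 'I_n}) (s : {perm 'I_n}) :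
  uniq q -> size q = l -> #|H| = l ->
  (forall x, s x = flip q x :> nat) ->
  (2 * #|H :&: seed_vertices n l|%SET <= l)%N ||
  (2 * #|(s @^-1: H) :&: seed_vertices n l|%SET <= l)%N.
Proof.
move=> uq szq Hl hs.
set a := #|_ :&: _|%SET; set B := ((s @^-1: H) :&: _)%SET.
suff : (a + #|B| <= l)%N by case: leqP => //=; lia.
rewrite -[leqRHS]Hl -(card_imset B (@perm_inj _ s)) /a -cardsUI.
have -> : ((H :&: seed_vertices n l) :&: (s @: B))%SET = finset.set0.
  apply/setP => x; rewrite !inE; apply/negP => /andP[/andP[_ xl]] /imsetP[y].
  rewrite !inE => /andP[_ yl] e; have := flip_seed uq szq yl.
  by rewrite -hs -e leqNgt xl.
rewrite cards0 addn0 subset_leq_card//; apply/fintype.subsetP => x.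
by rewrite !inE => /orP[/andP[]//|/imsetP[y]]; rewrite !inE => /andP[yH _] ->.
Qed.

(** * Finite histories, their number and their probabilities *)

Notation attachments l m := {dffun forall k : 'I_m, 'I_(k + l)}.

(** Histories of m choices form a finite type that can be counted, while [ua_tree] and
    [independent_inputs] take families indexed by all naturals; [d] fills the gap. Matching on [idP]
    supplies the proof of k < m. *)
Definition extend (l m : nat) (d : forall k : nat, 'I_(k + l))
    (g : attachments l m) (k : nat) : 'I_(k + l) :=
  if @idP (k < m)%N is ReflectT km then g (Ordinal km) else d k.

Lemma extendE (l m : nat) (d : forall k : nat, 'I_(k + l))
    (g : attachments l m) (k : nat) (km : (k < m)%N) :
  extend d g k = g (Ordinal km).
Proof.
rewrite /extend; case: {-}_ / idP => // km'.
by rewrite (bool_irrelevance km' km).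
Qed.

(** Reindexing by [f] shows that p and p o f have the same sum over [E], so twice this sum is at
    least the size of [E]. *)
Lemma sum_involution_ge (R : realFieldType) (T : finType) (E : {set T})
    (f : T -> T) (p : T -> R) : involutive f ->
  (forall x, x \in E -> f x \in E) ->
  (forall x, x \in E -> 1 <= p x + p (f x)) ->
  #|E|%:R / 2 <= \sum_(x in E) p x.
Proof.
move=> fK fE pf.
have e : \sum_(x in E) p (f x) = \sum_(x in E) p x.
  rewrite [RHS](reindex_inj (inv_inj fK)); apply: eq_bigl => x.
  by apply/idP/idP => /fE//; rewrite fK.
have : \sum_(x in E) 1 <= \sum_(x in E) (p x + p (f x)) by exact: ler_sum.
by rewrite big_split /= e sumr_const; lra.
Qed.

Lemma finType_fsbig (R : Type) (idx : R) (op : Monoid.com_law idx)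
    (T : finType) (F : T -> R) :
  \big[op/idx]_(x \in [set: T]) F x = \big[op/idx]_x F x.
Proof.
rewrite fsbig_finite//=; rewrite (perm_big (index_enum T)) //; apply: uniq_perm => [||x].
- exact: finmap.fset_uniq.
- exact: index_enum_uniq.
- by rewrite mem_index_enum in_fset_set; [exact: mem_set|exact: finite_finset].
Qed.

(** Independence only speaks of product events, so the event is cut into the pieces [F x] on which
    the history and the relabelling are fixed. Each piece is a product event, and its discrete
    factors are uniform. *)
Lemma independent_inputs_prob (d dW : measure_display) (O : measurableType d)
    (W : measurableType dW) (R : realType) (P : probability O R) (l m : nat)
    (c : forall k : nat, O -> 'I_(k + l)) (s : O -> {perm 'I_(m + l)})
    (U : O -> W) (c0 : forall k : nat, 'I_(k + l))
    (V : attachments l m -> {perm 'I_(m + l)} -> set W) :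
  (forall k, (k < m)%N -> uniform_on P (c k)) -> uniform_on P s ->
  measurable_fun setT U -> independent_inputs P c s U ->
  (forall g t, measurable (V g t)) ->
  P [set w | V (finfun (fun k : 'I_m => c k w)) (s w) (U w)] =
  (((\prod_(k < m) (k + l))%N%:R * (m + l)`!%:R)^-1 *
    \sum_x fine (P (U @^-1` V x.1 x.2)))%:E.
Proof.
move=> hc hs hU hind mV.
have mUV g t : measurable (U @^-1` V g t).
  by rewrite -[X in measurable X]setTI; apply: hU.
pose F (x : attachments l m * {perm 'I_(m + l)}) : set O :=
  (\bigcap_(k in [set k | (k < m)%N]) (c k @^-1` [set extend c0 x.1 k])) `&`
  (s @^-1` [set x.2]) `&` (U @^-1` V x.1 x.2).
have FE x w : F x w <-> [/\ finfun (fun k : 'I_m => c k w) = x.1, s w = x.2 &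
    V x.1 x.2 (U w)].
  split=> [[[h1 h2] h3]|[h1 h2 h3]].
    by split=> //; apply/ffunP => -[k km]; rewrite ffunE (h1 k km) (extendE _ _ km).
  refine (conj (conj _ h2) h3) => k /= km; rewrite (extendE _ _ km) -h1 ffunE//.
have -> : [set w | V (finfun (fun k : 'I_m => c k w)) (s w) (U w)] =
    \bigcup_(x in [set: _]) F x.
  apply/seteqP; split=> w /=.
    by move=> h; exists (finfun (fun k : 'I_m => c k w), s w) => //; apply/FE.
  by move=> [x _ /FE[-> -> ]].
rewrite measure_fin_bigcup//; last 2 first.
- apply/trivIsetP => x y _ _ xy; apply/seteqP; split=> // w.
  move=> [/FE[x1 x2 _] /FE[y1 y2 _]]; move/eqP: xy; apply.
  by case: x y x1 x2 y1 y2 => [? ?] [? ?] /= <- <- <- <-.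
- move=> x _; apply: measurableI => //; apply: measurableI; last exact: (hs.1).
  by apply: bigcap_measurableType => k km; exact: (hc k km).1.
rewrite (finType_fsbig _ (fun x => P (F x))).
under eq_bigr => x _.
  rewrite hind// (hs.2) -[P (U @^-1` _)]fineK ?fin_num_measure//.
  under eq_bigr => k _ do rewrite (hc k (ltn_ord k)).2 card_ord.
  rewrite -(big_morph EFin EFinM erefl) -!EFinM card_Sn prodfV -natr_prod -invfM.
  over.
by rewrite sumEFin -mulr_sumr.
exact: finite_finset.
Qed.

Lemma relabelM (n : nat) (s t : {perm 'I_n}) (E : graph n) :
  relabel (s * t)%g E = relabel t (relabel s E).
Proof.
rewrite /relabel -imset_comp; apply: eq_imset => e /=.
by rewrite -imset_comp; apply: eq_imset => x /=; rewrite permM.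
Qed.

(** The set is a product, with one admissible value for each k < l and k + l values for each later
    k. *)
Lemma card_forced_prefix (l m : nat) (v : nat -> nat) :
  (l <= m)%N -> (forall k, (k < l)%N -> (v k < k + l)%N) ->
  (#|[set g : attachments l m |
      [forall k : 'I_m, (k < l)%N ==> (g k == v k :> nat)]]%SET| *
    \prod_(k < l) (k + l) = \prod_(k < m) (k + l))%N.
Proof.
move=> lm hv.
pose F (k : 'I_m) : pred 'I_(k + l) := [pred y : 'I_(k + l) | (k < l)%N ==> (y == v k :> nat)].
have -> : #|[set g : attachments l m |
      [forall k : 'I_m, (k < l)%N ==> (g k == v k :> nat)]]%SET| =
      #|(family F : simpl_pred (attachments l m))|.
  by apply: eq_card => g; rewrite inE.
rewrite card_family foldrE big_map big_enum /=.
rewrite (big_ord_widen m (fun k => (k + l)%N) lm) [in X in (_ * X)%N]big_mkcond -big_split.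
apply: eq_bigr => k _ /=; case: ifP => kl; last first.
  by rewrite muln1 -[RHS]card_ord; apply: eq_card => y; rewrite inE kl.
rewrite -[RHS]mul1n; congr muln; rewrite -(card1 (Ordinal (hv k kl))).
by apply: eq_card => y; rewrite !inE kl -val_eqE.
Qed.

(** * Pairing histories to bound the failure probability *)

Theorem theorem2 (R : realType) (eps : R) (l m : nat) (S : graph l)
    (heps0 : 0 < eps) (heps1 : eps < expR (- expR 2))
    (hl1 : (1 <= l)%N)
    (hl : l%:R <= ln (1 / eps) / ln (ln (1 / eps)))
    (hS : is_path S)
    (hn : (2 * l <= m + l)%N)
    (d dW : measure_display) (O : measurableType d) (W : measurableType dW)
    (P : probability O R)
    (c : forall k : nat, O -> 'I_(k + l))
    (s : O -> {perm 'I_(m + l)})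
    (U : O -> W)
    (hc : forall k : nat, (k < m)%N -> uniform_on P (c k))
    (hs : uniform_on P s)
    (hU : measurable_fun setT U)
    (hind : independent_inputs P c s U)
    (A : W -> graph (m + l) -> {set 'I_(m + l)})
    (hA : seed_finding_algorithm l A) :
  (eps%:E <=
   P [set w : O |
        let T := ua_tree S (fun k => c k w) m in
        let H := found_set A (U w) (s w) T in
        (#|(H :&: seed_vertices (m + l) l)%SET|%:R <= l%:R / 2 :> R)%R])%E.
Proof.
have l0 := hl1; have lm : (l <= m)%N by lia.
have [tS _] := hS; have [q [uq szq qS]] := path_seed_edges hS.
pose c0 k : 'I_(k + l) := Ordinal (ltn_addl k l0).
pose T (g : attachments l m) := ua_tree S (extend c0 g) m.
have tT g : is_tree (T g) by exact: ua_tree_tree.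
pose V (g : attachments l m) (t : {perm 'I_(m + l)}) : set W := [set u |
  (2 * #|(t @^-1: A u (relabel t (T g))) :&: seed_vertices (m + l) l|%SET <= l)%N].
have mV g t : measurable (V g t).
  have [mA _] := hA _ (relabel_tree t (tT g)).
  (* On a fixed observed tree the output takes finitely many values, each on a measurable set. *)
  have -> : V g t = \bigcup_(H in [set H : {set 'I_(m + l)} |
      (2 * #|(t @^-1: H) :&: seed_vertices (m + l) l|%SET <= l)%N])
      [set u | A u (relabel t (T g)) = H].
    apply/seteqP; split=> [u hu|u [H /= hH eH]]; last by rewrite /V /= eH.
    by exists (A u (relabel t (T g))).
  by apply: fin_bigcup_measurable => //; exact: finite_finset.
rewrite (_ : [set w | _] =
    [set w | V (finfun (fun k : 'I_m => c k w)) (s w) (U w)]); last first.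
  apply/seteqP; split=> w /=; rewrite ler_pdivlMr// -natrM ler_nat mulnC /V /= /found_set;
  rewrite (_ : T _ = ua_tree S (fun k => c k w) m)//; apply: eq_ua_tree => k km;
  by rewrite (extendE _ _ km) ffunE.
rewrite (independent_inputs_prob c0 hc hs hU hind mV) lee_fin.
pose phi : {perm 'I_(m + l)} := perm (inv_inj (flip_ordK uq szq hn)).
have hphi x : phi x = flip q x :> nat by rewrite permE val_flip_ord.
have phiK : involutive phi by move=> x; apply: val_inj; rewrite /= !hphi flipK.
(* The first l choices, which build the long path, are kept, and later parents are reversed; for k
   >= l the reversal does act on ['I_(k + l)]. The product [phi * x.2] applies [phi] first. *)
pose Psi (x : attachments l m * {perm 'I_(m + l)}) :
    (attachments l m) * {perm 'I_(m + l)} :=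
  (finfun (fun k : 'I_m => if (k < l)%N then x.1 k else flip_ord q (x.1 k)),
   (phi * x.2)%g).
have PsiK : involutive Psi.
  move=> [g t]; congr pair => /=.
    apply/ffunP => k; rewrite ffunE; case: ifP => kl; rewrite ffunE kl//.
    by rewrite flip_ordK//; lia.
  by apply/permP => x; rewrite !permM phiK.
pose E1 := [set g : attachments l m |
      [forall k : 'I_m, (k < l)%N ==> (g k == node q (k + l).-1 :> nat)]]%SET.
pose E := finset.setX E1 [set: {perm 'I_(m + l)}]%SET.
have EPsi x : x \in E -> Psi x \in E.
  rewrite !inE !andbT => /forallP h; apply/forallP => k; apply/implyP => kl.
  by rewrite ffunE kl (implyP (h k)).
pose p (x : attachments l m * {perm 'I_(m + l)}) : R :=
  fine (P (U @^-1` V x.1 x.2)).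
have mUV g t : measurable (U @^-1` V g t).
  by rewrite -[X in measurable X]setTI; apply: hU.
(* For each value u of the internal randomness, the algorithm fails on [x] or on [Psi x]; the two
   events cover the whole space. *)
have p_ge1 x : x \in E -> 1 <= p x + p (Psi x).
  move=> xE.
  have VV u : V x.1 x.2 u \/ V (Psi x).1 (Psi x).2 u.
    have eT : T (Psi x).1 = relabel phi (T x.1).
      apply: (relabel_ua_tree_flip (q := q)) => //= k kl.
      - have km := leq_trans kl lm.
        rewrite (extendE _ _ km); move: xE; rewrite !inE andbT.
        by move=> /forallP/(_ (Ordinal km))/implyP/(_ kl)/eqP.
      - have km := leq_trans kl lm.
        rewrite (extendE _ _ km); move/EPsi: xE; rewrite !inE andbT.
        by move=> /forallP/(_ (Ordinal km))/implyP/(_ kl)/eqP.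
      - have [lk km] := andP kl.
        by rewrite !(extendE _ _ km) ffunE /= ltnNge lk /= val_flip_ord//; lia.
    (* The two reversals cancel, so the same tree is observed. *)
    have eR : relabel (Psi x).2 (T (Psi x).1) = relabel x.2 (T x.1).
      rewrite eT -relabelM /= mulgA; congr (relabel _ _).
      by apply/permP => y; rewrite !permM phiK.
    have := @flip_half l _ q (x.2 @^-1: A u (relabel x.2 (T x.1)))%SET phi uq szq.
    rewrite card_preimset; last exact: perm_inj.
    have [_ ->] := hA _ (relabel_tree x.2 (tT x.1)).
    move=> /(_ erefl hphi)/orP[h|h]; [left|right] => //.
    rewrite /V /= eR; congr (2 * #|_ :&: _| <= l)%N : h.
    by apply/setP => y; rewrite !inE permM.
  rewrite -lee_fin EFinD !fineK ?fin_num_measure// -(probability_setT P).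
  apply: le_trans (measureU2 _ (mUV _ _) (mUV _ _)).
  apply: le_measure; rewrite ?inE//; first exact: measurableU.
  by move=> w _; exact: VV.
have hsum : #|E|%:R / 2 <= \sum_x p x.
  apply: le_trans (sum_involution_ge PsiK EPsi p_ge1) _.
  rewrite [leRHS](bigID (mem E)) /= lerDl sumr_ge0// => x _.
  exact: fine_ge0.
apply: le_trans (eps_le_inv_prod heps0 heps1 hl1 hl) _.
have hE : (#|E1| * \prod_(k < l) (k + l) = \prod_(k < m) (k + l))%N.
  apply: (card_forced_prefix (v := fun k => node q (k + l).-1) lm) => k kl.
  (* The first forced parent is the last seed vertex of the list, at position l - 1; for k > 0 it is
     the vertex of value k + l - 1. *)
  case: (posnP k) => [->|k0].
    by rewrite add0n node_lt//; lia.
  by rewrite node_ge//; lia.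
rewrite ler_pdivlMl; last by rewrite mulr_gt0 ?ltr0n ?fact_gt0 ?prodn_gt0// => i; lia.
apply: le_trans hsum.
(* Both sides are now equal: the histories in [E1] are a fraction 1 / [\prod_(k < l) (k + l)] of
   all, and the factorial cancels. *)
rewrite cardsX cardsT card_Sn -hE !natrM.
have C0 : (\prod_(k < l) (k + l))%N%:R != 0 :> R.
  by rewrite pnatr_eq0 -lt0n prodn_gt0// => i; lia.
by rewrite le_eqVlt; apply/orP; left; apply/eqP; field.
Qed.
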